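(* Let $(H,\mu,\Delta,\eta,\epsilon,S)$ be a Hopf algebra over a unital commutative ring $\mathbb{k}$ and let $R_H:H\otimes H\to H\otimes H$ be the Yang-Baxter operator given by $$R_H(x\otimes y)=y^{(1)}\otimes S(y^{(2)})\,x\,y^{(3)}.$$ Then $(H,\mu,R_H)$ is a braided algebra.
   Context: Sweedler notation is used: $y^{(1)}\otimes y^{(2)}\otimes y^{(3)}$ is the iterated comultiplication of $y$ (summation suppressed), and juxtaposition is multiplication in $H$. Let $1$ denote the identity map. A Yang-Baxter operator on a $\mathbb{k}$-module $V$ is an invertible map $R:V\otimes V\to V\otimes V$ with $(R\otimes 1)(1\otimes R)(R\otimes 1)=(1\otimes R)(R\otimes 1)(1\otimes R)$. A braided algebra $(V,\mu,R)$ is an associative $\mathbb{k}$-algebra $(V,\mu)$ with a Yang-Baxter operator $R$ satisfying $(1\otimes\mu)(R\otimes 1)(1\otimes R)=R(\mu\otimes 1)$ (YI condition) and $(\mu\otimes 1)(1\otimes R)(R\otimes 1)=R(1\otimes\mu)$ (IY condition). It is taken as known that $R_H$ is a Yang-Baxter operator. *)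

(* Defs.v *)
From HB Require Import structures.
From mathcomp Require Import all_boot all_order all_algebra.
From mathcomp Require Import boolp.

Set Implicit Arguments.
Unset Strict Implicit.
Unset Printing Implicit Defensive.

Import GRing.Theory.
Local Open Scope ring_scope.
Local Open Scope quotient_scope.

Reserved Notation "U ⊗ V" (at level 40, left associativity).
Reserved Notation "u ⊗ₜ v" (at level 40, left associativity).

Definition bilin (R : pzRingType) (U V W : lmodType R) (f : U -> V -> W) : Prop :=
  (forall v, linear (f^~ v)) /\ (forall u, linear (f u)).

Section Tensor.
Variables (R : comPzRingType) (U V : lmodType R).

(* A list of pairs stands for the formal sum of its entries. [tens_rel] is the *)
(* congruence on formal sums generated by commutativity and bilinearity;       *)
(* multiples a (u, v) need not be formal since a (u ⊗ v) = (a u) ⊗ v.          *)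
Inductive tens_rel : seq (U * V) -> seq (U * V) -> Prop :=
  | tens_refl s : tens_rel s s
  | tens_sym s t : tens_rel s t -> tens_rel t s
  | tens_trans s t r : tens_rel s t -> tens_rel t r -> tens_rel s r
  | tens_cat s s' t t' :
      tens_rel s s' -> tens_rel t t' -> tens_rel (s ++ t) (s' ++ t')
  | tens_catC s t : tens_rel (s ++ t) (t ++ s)
  | tens_0 v : tens_rel [:: (0, v)] [::]
  | tens_Dl u u' v : tens_rel [:: (u + u', v)] [:: (u, v); (u', v)]
  | tens_Dr u v v' : tens_rel [:: (u, v + v')] [:: (u, v); (u, v')]
  | tens_Z a u v : tens_rel [:: (a *: u, v)] [:: (u, a *: v)].

Definition tens_relb s t := `[< tens_rel s t >].

Lemma tens_relb_refl : reflexive tens_relb.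
Proof. by move=> s; apply/asboolP; exact: tens_refl. Qed.

Lemma tens_relb_sym : symmetric tens_relb.
Proof. by move=> s t; apply/asboolP/asboolP => /tens_sym. Qed.

Lemma tens_relb_trans : transitive tens_relb.
Proof.
by move=> t s r /asboolP h1 /asboolP h2; apply/asboolP; exact: tens_trans h1 h2.
Qed.

Canonical tens_equiv :=
  EquivRel tens_relb tens_relb_refl tens_relb_sym tens_relb_trans.

Definition tensor : Type := {eq_quot tens_equiv}.

HB.instance Definition _ := Choice.on tensor.

Definition tcls (s : seq (U * V)) : tensor := \pi_{eq_quot tens_equiv} s.

Lemma tclsP s t : reflect (tens_rel s t) (tcls s == tcls t).
Proof. by rewrite /tcls piE; apply: asboolP. Qed.

Lemma tcls_eq s t : tens_rel s t -> tcls s = tcls t.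
Proof. by move=> h; apply/eqP/tclsP. Qed.

Lemma tcls_rel s t : tcls s = tcls t -> tens_rel s t.
Proof. by move/eqP/tclsP. Qed.

Lemma tclsK (x : tensor) : tcls (repr x) = x.
Proof. exact: reprK. Qed.

Lemma tens_rel_repr s : tens_rel (repr (tcls s)) s.
Proof. by apply: tcls_rel; rewrite tclsK. Qed.

Definition fscale (a : R) (s : seq (U * V)) := [seq (a *: p.1, p.2) | p <- s].

Lemma fscale_rel a s t : tens_rel s t -> tens_rel (fscale a s) (fscale a t).
Proof.
elim=> {s t}.
- by move=> s; exact: tens_refl.
- by move=> s t _; exact: tens_sym.
- by move=> s t r _ h1 _; exact: tens_trans h1.
- by move=> s s' t t' _ h1 _ h2; rewrite /fscale !map_cat; exact: tens_cat.
- by move=> s t; rewrite /fscale !map_cat; exact: tens_catC.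
- by move=> v; rewrite /fscale /= scaler0; exact: tens_0.
- by move=> u u' v; rewrite /fscale /= scalerDr; exact: tens_Dl.
- by move=> u v v'; exact: tens_Dr.
- move=> b u v; rewrite /fscale /= scalerA mulrC -scalerA; exact: tens_Z.
Qed.

Definition tadd (x y : tensor) : tensor := tcls (repr x ++ repr y).
Definition tscale (a : R) (x : tensor) : tensor := tcls (fscale a (repr x)).

Lemma tadd_cls s t : tadd (tcls s) (tcls t) = tcls (s ++ t).
Proof. by apply: tcls_eq; apply: tens_cat; exact: tens_rel_repr. Qed.

Lemma tscale_cls a s : tscale a (tcls s) = tcls (fscale a s).
Proof. by apply: tcls_eq; apply: fscale_rel; exact: tens_rel_repr. Qed.

Lemma taddA : associative tadd.
Proof.
move=> x y z; rewrite -[x]tclsK -[y]tclsK -[z]tclsK.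
by rewrite !tadd_cls catA.
Qed.

Lemma taddC : commutative tadd.
Proof.
move=> x y; rewrite -[x]tclsK -[y]tclsK !tadd_cls.
by apply: tcls_eq; exact: tens_catC.
Qed.

Lemma tadd0 : left_id (tcls [::]) tadd.
Proof. by move=> x; rewrite -[x]tclsK tadd_cls. Qed.

Lemma fscale0_rel s : tens_rel (fscale 0 s) [::].
Proof.
elim: s => [|[u v] s ih]; first exact: tens_refl.
rewrite /fscale /= scale0r -cat1s -[[::]]cats0.
by apply: tens_cat ih; exact: tens_0.
Qed.

Lemma fscaleD_rel a b s : tens_rel (fscale (a + b) s) (fscale a s ++ fscale b s).
Proof.
elim: s => [|[u v] s ih]; first exact: tens_refl.
rewrite /fscale /= scalerDl -cat1s.
apply: (tens_trans (tens_cat (tens_Dl _ _ _) ih)).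
rewrite -/(fscale a s) -/(fscale b s).
apply: (tens_cat (s := [:: (a *: u, v)]) (s' := [:: (a *: u, v)])
  (t := [:: (b *: u, v)] ++ (fscale a s ++ fscale b s))
  (t' := fscale a s ++ ([:: (b *: u, v)] ++ fscale b s))).
  exact: tens_refl.
rewrite !catA; apply: tens_cat; first exact: tens_catC.
exact: tens_refl.
Qed.

Definition topp (x : tensor) : tensor := tscale (-1) x.

Lemma taddN : left_inverse (tcls [::]) topp tadd.
Proof.
move=> x; rewrite -[x]tclsK /topp tscale_cls tadd_cls; apply: tcls_eq.
apply: tens_trans (fscale0_rel (repr x)).
rewrite -(addNr 1); apply: tens_trans (tens_sym (fscaleD_rel _ _ _)).
have -> : fscale 1 (repr x) = repr x.
  by rewrite /fscale -[RHS]map_id; apply: eq_map => -[u v]; rewrite /= scale1r.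
exact: tens_refl.
Qed.

HB.instance Definition _ :=
  GRing.isZmodule.Build tensor taddA taddC tadd0 taddN.

Lemma tscaleA a b x : tscale a (tscale b x) = tscale (a * b) x.
Proof.
rewrite -[x]tclsK !tscale_cls /fscale -map_comp; congr tcls.
by apply: eq_map => p; rewrite /= scalerA.
Qed.

Lemma tscale1 : left_id 1 tscale.
Proof.
move=> x; rewrite -[x]tclsK tscale_cls; congr tcls.
by rewrite /fscale -[RHS]map_id; apply: eq_map => -[u v]; rewrite /= scale1r.
Qed.

Lemma tscaleDr : right_distributive tscale +%R.
Proof.
move=> a x y; rewrite -[x]tclsK -[y]tclsK.
by rewrite -[_ + _]/(tadd _ _) -[RHS]/(tadd _ _) tadd_cls !tscale_cls tadd_cls
  /fscale map_cat.
Qed.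

Lemma tscaleDl x : {morph tscale^~ x : a b / a + b}.
Proof.
move=> a b; rewrite -[x]tclsK -[RHS]/(tadd _ _) !tscale_cls tadd_cls.
by apply: tcls_eq; exact: fscaleD_rel.
Qed.

HB.instance Definition _ := GRing.Zmodule_isLmodule.Build R tensor
  tscaleA tscale1 tscaleDr tscaleDl.

Definition tens (u : U) (v : V) : tensor := tcls [:: (u, v)].

Lemma tens_bilin : bilin tens.
Proof.
split=> [v a u u'|u a v v'].
- rewrite -[RHS]/(tadd (tscale _ _) _) tscale_cls tadd_cls.
  by apply: tcls_eq; exact: tens_Dl.
- rewrite -[RHS]/(tadd (tscale _ _) _) tscale_cls tadd_cls; apply: tcls_eq.
  apply: (tens_trans (tens_Dr _ _ _)).
  apply: (tens_trans _ (tens_cat (tens_sym (tens_Z a u v)) (tens_refl _))).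
  exact: tens_refl.
Qed.

Lemma tcls_sum s : tcls s = \sum_(p <- s) tens p.1 p.2.
Proof.
elim: s => [|[u v] s ih]; first by rewrite big_nil.
by rewrite big_cons /= -ih -[RHS]/(tadd _ _) tadd_cls.
Qed.

(* Every tensor is a finite sum of pure tensors. *)
Lemma tensor_sum (x : tensor) : x = \sum_(p <- repr x) tens p.1 p.2.
Proof. by rewrite -tcls_sum tclsK. Qed.

Section Lift.
Variable W : lmodType R.

(* The value at [x] of the linear map induced by [f], for [f] bilinear         *)
(* (see [tliftE], [tlift_linear] and [tensor_ext]). This is Sweedler notation: *)
(* write x as a sum of terms u ⊗ v and add up the f u v.                       *)
Definition tlift (f : U -> V -> W) (x : tensor) : W :=
  \sum_(p <- repr x) f p.1 p.2.

Lemma bilin_rel (f : U -> V -> W) s t : bilin f -> tens_rel s t ->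
  \sum_(p <- s) f p.1 p.2 = \sum_(p <- t) f p.1 p.2.
Proof.
move=> [fl fr]; elim=> {s t}.
- by [].
- by move=> s t _ ->.
- by move=> s t r _ -> _ ->.
- by move=> s s' t t' _ h1 _ h2; rewrite !big_cat /= h1 h2.
- by move=> s t; rewrite !big_cat /= addrC.
- move=> v; rewrite big_seq1 big_nil /=.
  by have := fl v (-1) 0 0; rewrite scaler0 addr0 scaleN1r addNr.
- move=> u u' v; rewrite !(big_cons, big_nil) /= !addr0.
  by have := fl v 1 u u'; rewrite !scale1r.
- move=> u v v'; rewrite !(big_cons, big_nil) /= !addr0.
  by have := fr u 1 v v'; rewrite !scale1r.
- move=> a u v; rewrite !big_seq1 /=.
  have fl0 : f 0 v = 0.
    by have := fl v (-1) 0 0; rewrite scaler0 addr0 scaleN1r addNr.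
  have fr0 : f u 0 = 0.
    by have := fr u (-1) 0 0; rewrite scaler0 addr0 scaleN1r addNr.
  have := fl v a u 0; rewrite /= !addr0 fl0 addr0 => ->.
  by have := fr u a v 0; rewrite !addr0 fr0 addr0 => ->.
Qed.

Lemma tlift_cls (f : U -> V -> W) s : bilin f -> tlift f (tcls s) = \sum_(p <- s) f p.1 p.2.
Proof. by move=> fb; apply: bilin_rel => //; exact: tens_rel_repr. Qed.

Lemma tliftE (f : U -> V -> W) u v : bilin f -> tlift f (tens u v) = f u v.
Proof. by move=> fb; rewrite tlift_cls // big_seq1. Qed.

Lemma tlift_linear (f : U -> V -> W) : bilin f -> linear (tlift f).
Proof.
move=> fb a x y; rewrite -[x]tclsK -[y]tclsK.
rewrite -[_ + _ in LHS]/(tadd (tscale _ _) _) tscale_cls tadd_cls !tlift_cls //.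
rewrite big_cat /= big_map; congr (_ + _); rewrite scaler_sumr.
apply: eq_bigr => -[u v] _ /=.
have f0 : f 0 v = 0.
  by have := fb.1 v (-1) 0 0; rewrite scaler0 addr0 scaleN1r addNr.
by have := fb.1 v a u 0; rewrite /= !addr0 f0 addr0.
Qed.

Lemma tensor_ext (f g : {linear tensor -> W}) :
  (forall u v, f (tens u v) = g (tens u v)) -> f =1 g.
Proof.
move=> fg x; rewrite [x]tensor_sum !linear_sum /=.
by apply: eq_bigr => p _; exact: fg.
Qed.

Lemma tliftP (a : R) f g x :
  tlift (fun u v => a *: f u v + g u v) x = a *: tlift f x + tlift g x.
Proof. by rewrite /tlift big_split /= scaler_sumr. Qed.

Lemma eq_tlift f g : (forall u v, f u v = g u v) -> tlift f =1 tlift g.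
Proof. by move=> fg x; apply: eq_bigr => p _; exact: fg. Qed.

End Lift.

End Tensor.

Arguments tens {R U V}.
Arguments tlift {R U V W}.

Notation "U ⊗ V" := (tensor U V).
Notation "u ⊗ₜ v" := (tens u v) : ring_scope.

Section Maps.
Variable R : comPzRingType.

Definition tmap (U V U' V' : lmodType R) (f : U -> U') (g : V -> V') :
  U ⊗ V -> U' ⊗ V' := tlift (fun u v => f u ⊗ₜ g v).

Definition assocr (U V W : lmodType R) : (U ⊗ V) ⊗ W -> U ⊗ (V ⊗ W) :=
  tlift (fun p w => tlift (fun u v => u ⊗ₜ (v ⊗ₜ w)) p).

Definition assocl (U V W : lmodType R) : U ⊗ (V ⊗ W) -> (U ⊗ V) ⊗ W :=
  tlift (fun u p => tlift (fun v w => (u ⊗ₜ v) ⊗ₜ w) p).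

End Maps.

Arguments assocr {R U V W}.
Arguments assocl {R U V W}.

Section BraidedAlgebra.
Variables (k : comPzRingType) (V : lmodType k).

Definition associative_mul (mu : {linear V ⊗ V -> V}) : Prop :=
  forall x y z, mu (mu (x ⊗ₜ y) ⊗ₜ z) = mu (x ⊗ₜ mu (y ⊗ₜ z)).

(* V ⊗ V ⊗ V is bracketed as (V ⊗ V) ⊗ V. *)
Definition on12 (f : V ⊗ V -> V ⊗ V) : (V ⊗ V) ⊗ V -> (V ⊗ V) ⊗ V :=
  tmap f idfun.
Definition on23 (f : V ⊗ V -> V ⊗ V) : (V ⊗ V) ⊗ V -> (V ⊗ V) ⊗ V :=
  assocl \o tmap idfun f \o assocr.
Definition mul12 (mu : V ⊗ V -> V) : (V ⊗ V) ⊗ V -> V ⊗ V := tmap mu idfun.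
Definition mul23 (mu : V ⊗ V -> V) : (V ⊗ V) ⊗ V -> V ⊗ V :=
  tmap idfun mu \o assocr.

Record yang_baxter_operator (r : {linear V ⊗ V -> V ⊗ V}) : Prop := {
  yb_invertible : bijective r;
  yb_equation : on12 r \o on23 r \o on12 r =1 on23 r \o on12 r \o on23 r
}.

Record braided_algebra (mu : {linear V ⊗ V -> V})
    (r : {linear V ⊗ V -> V ⊗ V}) : Prop := {
  ba_assoc : associative_mul mu;
  ba_yang_baxter : yang_baxter_operator r;
  ba_YI : mul23 mu \o on12 r \o on23 r =1 r \o mul12 mu;
  ba_IY : mul12 mu \o on23 r \o on12 r =1 r \o mul23 mu
}.

End BraidedAlgebra.

Section HopfAlgebra.
Variables (k : comPzRingType) (H : lmodType k).
Variables (mu : {linear H ⊗ H -> H}) (Delta : {linear H -> H ⊗ H}).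
Variables (eta : {linear k^o -> H}) (eps : {linear H -> k^o}).
Variable S : {linear H -> H}.

(* The multiplication of the algebra H ⊗ H. *)
Definition tensor_mul (s t : H ⊗ H) : H ⊗ H :=
  tlift (fun a b => tlift (fun c d => mu (a ⊗ₜ c) ⊗ₜ mu (b ⊗ₜ d)) t) s.

Record hopf_algebra : Prop := {
  hopf_assoc : associative_mul mu;
  hopf_unitl : forall x, mu (eta 1 ⊗ₜ x) = x;
  hopf_unitr : forall x, mu (x ⊗ₜ eta 1) = x;
  hopf_coassoc : forall x,
    assocr (tmap Delta idfun (Delta x)) = tmap idfun Delta (Delta x);
  hopf_counitl : forall x, tlift (fun a b => eps a *: b) (Delta x) = x;
  hopf_counitr : forall x, tlift (fun a b => eps b *: a) (Delta x) = x;
  hopf_comulM : forall x y, Delta (mu (x ⊗ₜ y)) = tensor_mul (Delta x) (Delta y);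
  hopf_comul1 : Delta (eta 1) = eta 1 ⊗ₜ eta 1;
  hopf_counitM : forall x y, eps (mu (x ⊗ₜ y)) = eps x * eps y;
  hopf_counit1 : eps (eta 1) = 1;
  hopf_antipodel : forall x, mu (tmap S idfun (Delta x)) = eta (eps x);
  hopf_antipoder : forall x, mu (tmap idfun S (Delta x)) = eta (eps x)
}.

(* The iterated comultiplication, y |-> y^(1) ⊗ y^(2) ⊗ y^(3). *)
Definition comul3 (y : H) : (H ⊗ H) ⊗ H := tmap Delta idfun (Delta y).

Definition R_H_term (x y1 y2 y3 : H) : H ⊗ H :=
  y1 ⊗ₜ mu (mu (S y2 ⊗ₜ x) ⊗ₜ y3).

(* R_H is bijective if and only if the antipode S is: composing it with the    *)
(* bijection y ⊗ z |-> y^(1) ⊗ y^(2) z gives x ⊗ y |-> y^(1) ⊗ x y^(2), which  *)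
(* is bijective exactly when the co-opposite bialgebra has an antipode.        *)
Definition R_H : H ⊗ H -> H ⊗ H := tlift (fun x y =>
  tlift (fun y12 y3 => tlift (fun y1 y2 => R_H_term x y1 y2 y3) y12) (comul3 y)).

Let tl (a : k) (u u' v : H) : (a *: u + u') ⊗ₜ v = a *: (u ⊗ₜ v) + u' ⊗ₜ v.
Proof. exact: (tens_bilin H H).1. Qed.

Let tr (a : k) (u v v' : H) : u ⊗ₜ (a *: v + v') = a *: (u ⊗ₜ v) + u ⊗ₜ v'.
Proof. exact: (tens_bilin H H).2. Qed.

Lemma R_H_bilin_inner x y3 : bilin (fun y1 y2 => R_H_term x y1 y2 y3).
Proof.
by rewrite /R_H_term; split=> [y2 a u u'|y1 a u u'] /=;
  do ?rewrite ?linearP ?tl ?tr.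
Qed.

Lemma R_H_bilin_outer x :
  bilin (fun y12 y3 => tlift (fun y1 y2 => R_H_term x y1 y2 y3) y12).
Proof.
split=> [y3|y12 a u u'] /=; first exact/tlift_linear/R_H_bilin_inner.
rewrite -tliftP; apply: eq_tlift => y1 y2.
by rewrite /R_H_term; do ?rewrite ?linearP ?tl ?tr.
Qed.

Lemma tmap_bilin (U V U' V' : lmodType k) (f : {linear U -> U'})
  (g : {linear V -> V'}) : bilin (fun u v => f u ⊗ₜ g v).
Proof.
split=> [v a u u'|u a v v'] /=; rewrite linearP.
  exact: (tens_bilin U' V').1.
exact: (tens_bilin U' V').2.
Qed.

Lemma comul3_linear : linear comul3.
Proof.
move=> a x y; rewrite /comul3 linearP.
exact: (tlift_linear (tmap_bilin Delta idfun)).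
Qed.

Lemma R_H_bilin : bilin (fun x y =>
  tlift (fun y12 y3 => tlift (fun y1 y2 => R_H_term x y1 y2 y3) y12) (comul3 y)).
Proof.
split=> [y a x x'|x a y y'] /=.
  rewrite -tliftP; apply: eq_tlift => y12 y3.
  rewrite -tliftP; apply: eq_tlift => y1 y2.
  by rewrite /R_H_term; do ?rewrite ?linearP ?tl ?tr.
by rewrite comul3_linear; exact: (tlift_linear (R_H_bilin_outer x)).
Qed.

Lemma R_H_linear : linear R_H.
Proof. exact: tlift_linear R_H_bilin. Qed.

HB.instance Definition _ := GRing.isLinear.Build k _ _ _ R_H R_H_linear.

End HopfAlgebra.

(* Main.v *)
Require Import Defs.
From mathcomp Require Import all_boot all_order all_algebra.

Set Implicit Arguments.
Unset Strict Implicit.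
Unset Printing Implicit Defensive.

Import GRing.Theory.
Local Open Scope ring_scope.

(** Write x ◁ y = S(y1) x y2 for the right adjoint action, so that
    R_H (x ⊗ y) = y1 ⊗ (x ◁ y2). Everything rests on two facts:

    - y1 (x ◁ y2) = x y, by the antipode axiom (lemma [mul_adj]);
    - a linear map f on H is determined by the map y |-> y1 f(y2), because
      S(y1) y2 f(y3) = f(y); the same holds for f with values in any left
      H-module (lemma [sweedler_inj]).

    Hence x ◁ - is the unique linear map f such that y1 f(y2) = x y, and an
    identity about ◁ can be proved by checking it after this multiplication,
    where S disappears. Three identities are obtained in this way:

    - (x ◁ y) ◁ z = x ◁ (y z)  (lemma [adj_adj]), which with the
      multiplicativity of the comultiplication gives the IY condition;
    - (x y) ◁ z = (x ◁ z1) (y ◁ z2)  (lemma [adj_mul]), which gives the YI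
      condition;
    - (y1 ◁ z1) ⊗ y2 z2 = (y ◁ z2)_1 ⊗ z1 (y ◁ z2)_2  (lemma [comul_adj]);
      here both sides become Δ(y z) after the multiplication by z on the left
      factor of H ⊗ H. Applying x ◁ - to the second factor gives the
      Yang-Baxter equation, whose two sides at x ⊗ y ⊗ z are
      z1 ⊗ (y1 ◁ z2) ⊗ x ◁ (y2 z3)  and
      z1 ⊗ (y ◁ z3)_1 ⊗ x ◁ (z2 (y ◁ z3)_2). *)

(** * Linear maps and sums over tensors *)

Section LinearMaps.
Variable k : comPzRingType.
Implicit Types U V W X : lmodType k.

Lemma lin_id V : linear (fun x : V => x).
Proof. by []. Qed.

Lemma lin_comp U V W (f : V -> W) (g : U -> V) :
  linear f -> linear g -> linear (fun x => f (g x)).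
Proof. by move=> fL gL a x y; rewrite gL fL. Qed.

Lemma lin_bilinl U V W X (f : V -> X -> W) (g : U -> V) c :
  bilin f -> linear g -> linear (fun x => f (g x) c).
Proof. by move=> [fL _]; exact: (@lin_comp U V W (f^~ c)). Qed.

Lemma lin0 V W (f : V -> W) : linear f -> f 0 = 0.
Proof. by move=> fL; have := fL (-1) 0 0; rewrite scaler0 addr0 scaleN1r addNr. Qed.

Lemma linZ V W (f : V -> W) a x : linear f -> f (a *: x) = a *: f x.
Proof. by move=> fL; have := fL a x 0; rewrite !addr0 (lin0 fL) addr0. Qed.

Lemma lin_sum V W (f : V -> W) (I : Type) (r : seq I) (F : I -> V) :
  linear f -> f (\sum_(i <- r) F i) = \sum_(i <- r) f (F i).
Proof.
move=> fL; apply: (big_morph f) => [x y|]; last exact: lin0.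
by have := fL 1 x y; rewrite !scale1r.
Qed.

Lemma lin_tlift U V W X (f : W -> X) (g : U -> V -> W) t :
  linear f -> f (tlift g t) = tlift (fun u v => f (g u v)) t.
Proof. by move=> fL; rewrite /tlift lin_sum. Qed.

Lemma tensor3_ext U V W X (f g : (U ⊗ V) ⊗ W -> X) :
  linear f -> linear g ->
  (forall u v w, f ((u ⊗ₜ v) ⊗ₜ w) = g ((u ⊗ₜ v) ⊗ₜ w)) -> f =1 g.
Proof.
move=> fL gL fg t; rewrite [t]tensor_sum !lin_sum //.
apply: eq_bigr => -[p w] _ /=; rewrite [p]tensor_sum.
have tL : linear (fun q : U ⊗ V => q ⊗ₜ w) by exact: (tens_bilin _ _).1.
by rewrite (lin_sum _ _ tL) !lin_sum //; apply: eq_bigr => -[u v] _ /=.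
Qed.

Lemma lin_tlift_body U V W X (f : X -> U -> V -> W) t :
  (forall u v, linear (fun x => f x u v)) -> linear (fun x => tlift (f x) t).
Proof.
by move=> fL c x y; rewrite -tliftP; apply: eq_tlift => u v; exact: fL.
Qed.

Lemma tlift_exchange U V U' V' W (f : U -> V -> U' -> V' -> W) s t :
  tlift (fun u v => tlift (f u v) t) s =
  tlift (fun u' v' => tlift (fun u v => f u v u' v') s) t.
Proof. exact: exchange_big. Qed.

End LinearMaps.

(** * Sweedler calculus in a Hopf algebra *)

Create HintDb lin.

(** Proves that a lambda-term is linear, or bilinear, by recursion on its body:
    the terms met below are nested [tlift]s and (bi)linear operations in which
    the bound variable occurs once. The branches overlap, as the pattern ?f
    also matches open terms, on which [apply:] then fails; so [match] has to
    backtrack. *)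
Ltac lin := intros; cbv beta;
  match goal with
  | |- bilin (fun x => _) => split; lin
  | |- bilin (tens) => exact: tens_bilin
  | |- GRing.linear_for _ (fun x => x) => exact: lin_id
  | |- GRing.linear_for _ (tens _) => exact: (tens_bilin _ _).2
  | |- GRing.linear_for _ (fun x => x ⊗ₜ _) => exact: (tens_bilin _ _).1
  | |- GRing.linear_for _ (tlift _) => apply: tlift_linear; lin
  | |- GRing.linear_for _ (fun x => tlift (@?f x) ?t) =>
      apply: (lin_tlift_body (f := f) t); lin
  | |- GRing.linear_for _ (fun x => ?f (@?F x)) =>
      apply: (lin_comp (f := f) (g := F)); lin
  | |- GRing.linear_for _ (fun x => ?f (@?F x) ?c) =>
      apply: (lin_bilinl (f := f) (g := F) c); lin
  | |- _ => solve [assumption | exact: linearP | auto with lin]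
  end.

Section Braiding.
Variables (k : comPzRingType) (H : lmodType k).
Variables (mu : {linear H ⊗ H -> H}) (Delta : {linear H -> H ⊗ H}).
Variables (eta : {linear k^o -> H}) (eps : {linear H -> k^o}).
Variable S : {linear H -> H}.
Hypothesis hopfH : hopf_algebra mu Delta eta eps S.

Local Notation "x · y" := (mu (x ⊗ₜ y)) (at level 39, left associativity).
Local Notation "\Sw_ ( a , b <- y ) E" := (tlift (fun a b => E) (Delta y))
  (at level 41, a name, b name, y at level 40, E at level 41,
   format "\Sw_ ( a ,  b  <-  y )  E").

Lemma mulHA : associative (fun x y => x · y).
Proof. by move=> x y z; rewrite (hopf_assoc hopfH). Qed.

(** Any trilinear F factors through the linear map L on H ⊗ (H ⊗ H), which is
    applied to both sides of the coassociativity axiom. *)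
Lemma sweedler_coassoc (W : lmodType k) (F : H -> H -> H -> W) y :
  (forall b c, linear (fun a => F a b c)) ->
  (forall a c, linear (fun b => F a b c)) ->
  (forall a b, linear (fun c => F a b c)) ->
  \Sw_(a, c <- y) \Sw_(a', b <- a) F a' b c =
  \Sw_(a, b <- y) \Sw_(b', c <- b) F a b' c.
Proof.
move=> F1 F2 F3.
have FB a : bilin (F a) by split=> [c|b]; [exact: F2 | exact: F3].
pose L := tlift (fun a (p : H ⊗ H) => tlift (F a) p).
have LB : bilin (fun a (p : H ⊗ H) => tlift (F a) p) by lin.
have LL : linear L by exact: tlift_linear.
have := congr1 L (hopf_coassoc hopfH y).
rewrite /tmap /assocr !lin_tlift; try by lin.
move=> E; apply: etrans (etrans E _); apply: eq_tlift => a b.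
  rewrite tliftE; last by lin.
  rewrite lin_tlift //; apply: eq_tlift => c d.
  by rewrite /L !tliftE //; lin.
by rewrite /L tliftE.
Qed.

Lemma sweedler_mul (W : lmodType k) (f : H -> H -> W) x y :
  bilin f ->
  \Sw_(a, b <- x · y) f a b =
  \Sw_(a, b <- x) \Sw_(c, d <- y) f (a · c) (b · d).
Proof.
move=> fB; rewrite (hopf_comulM hopfH) /tensor_mul lin_tlift; last by lin.
apply: eq_tlift => a b; rewrite lin_tlift; last by lin.
by apply: eq_tlift => c d; rewrite tliftE.
Qed.

Lemma etaE (c : k) : c *: eta 1 = eta c.
Proof. by rewrite -linearZ; congr (eta _); exact: mulr1. Qed.

Lemma sweedler_antipodel y : \Sw_(a, b <- y) S a · b = eps y *: eta 1.
Proof.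
rewrite etaE -(hopf_antipodel hopfH) /tmap lin_tlift //.
exact: linearP.
Qed.

Lemma sweedler_antipoder y : \Sw_(a, b <- y) a · S b = eps y *: eta 1.
Proof.
rewrite etaE -(hopf_antipoder hopfH) /tmap lin_tlift //.
exact: linearP.
Qed.

Lemma sweedler_counitl (W : lmodType k) (f : H -> W) y :
  linear f -> \Sw_(a, b <- y) eps a *: f b = f y.
Proof.
move=> fL; rewrite -[in RHS](hopf_counitl hopfH y) lin_tlift //.
by apply: eq_tlift => a b; rewrite linZ.
Qed.

(** The operation f |-> (y |-> y1 f(y2)) is injective on linear maps from H to
    a left H-module W. A general W is wanted because [comul_adj] uses H ⊗ H
    with H acting on the first factor. *)
Section Cancellation.
Variables (W : lmodType k) (act : H -> W -> W).
Hypothesis act_bilin : bilin act.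
Hypothesis act1 : forall w, act (eta 1) w = w.
Hypothesis actM : forall a b w, act (a · b) w = act a (act b w).

(** S(y1) y2 f(y3) = eps(y1) f(y2) = f(y): acting with the antipode undoes the
    operation. *)
Lemma antipode_cancel (f : H -> W) y : linear f ->
  \Sw_(a, b <- y) act (S a) (\Sw_(c, d <- b) act c (f d)) = f y.
Proof.
move=> fL; have [actl actr] := act_bilin.
rewrite -[RHS]sweedler_counitl //.
transitivity (\Sw_(a, b <- y) \Sw_(c, d <- b) act (S a · c) (f d)).
  apply: eq_tlift => a b; rewrite lin_tlift //.
  by apply: eq_tlift => c d; rewrite actM.
rewrite -(sweedler_coassoc (F := fun a c d => act (S a · c) (f d))); try by lin.
apply: eq_tlift => a b.
have L : linear (act^~ (f b)) by lin.
by rewrite -(lin_tlift _ _ L) sweedler_antipodel (linZ _ _ L) act1.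
Qed.

Lemma sweedler_inj (f g : H -> W) : linear f -> linear g ->
  (forall y, \Sw_(a, b <- y) act a (f b) = \Sw_(a, b <- y) act a (g b)) ->
  f =1 g.
Proof.
move=> fL gL fg y; rewrite -[LHS]antipode_cancel // -[RHS]antipode_cancel //.
by apply: eq_tlift => a b; rewrite fg.
Qed.

End Cancellation.

Lemma sweedler_mul_inj (f g : H -> H) : linear f -> linear g ->
  (forall y, \Sw_(a, b <- y) a · f b = \Sw_(a, b <- y) a · g b) -> f =1 g.
Proof.
apply: (sweedler_inj (act := fun x y => x · y)); first by lin.
  exact: (hopf_unitl hopfH).
by move=> a b w; rewrite mulHA.
Qed.

(** * The right adjoint action *)

Definition adj (x y : H) : H := \Sw_(a, b <- y) S a · x · b.

Lemma adj_bilin : bilin adj.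
Proof. by rewrite /adj; lin. Qed.

Lemma adj_linear x : linear (adj x).
Proof. exact: adj_bilin.2. Qed.

Local Hint Resolve adj_bilin adj_linear : lin.

(** By coassociativity, y1 S(y2) x y3 = eps(y1) x y2. *)
Lemma mul_adj x y : \Sw_(a, b <- y) a · adj x b = x · y.
Proof.
transitivity (\Sw_(a, b <- y) \Sw_(c, d <- b) a · (S c · x · d)).
  by apply: eq_tlift => a b; rewrite /adj !lin_tlift //; lin.
rewrite -(sweedler_coassoc (F := fun a b c => a · (S b · x · c))); try by lin.
have L : linear (fun b => x · b) by lin.
rewrite -[RHS](sweedler_counitl y L); apply: eq_tlift => a b.
have L' : linear (fun e => e · x · b) by lin.
transitivity (\Sw_(c, d <- a) c · S d · x · b).
  by apply: eq_tlift => c d; rewrite !mulHA.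
by rewrite -(lin_tlift _ _ L') sweedler_antipoder (linZ _ _ L') (hopf_unitl hopfH).
Qed.

(** After cancelling first in z and then in y, both sides become x y z: the
    right one because y1 z1 (x ◁ (y2 z2)) is the sum over the components of the
    product y z. *)
Lemma adj_adj x y z : adj (adj x y) z = adj x (y · z).
Proof.
move: z; apply: sweedler_mul_inj => [||z]; try by lin.
rewrite mul_adj.
move: y; apply: sweedler_mul_inj => [||y]; try by lin.
transitivity (x · (y · z)).
  transitivity (\Sw_(a, b <- y) (a · adj x b) · z).
    by apply: eq_tlift => a b; rewrite mulHA.
  have L : linear (fun u => u · z) by lin.
  by rewrite -(lin_tlift _ _ L) mul_adj mulHA.
rewrite -mul_adj sweedler_mul; last by lin.
apply: eq_tlift => a b; rewrite !lin_tlift; try by lin.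
by apply: eq_tlift => c d; rewrite mulHA.
Qed.

(** Here z1 (x ◁ z2) (y ◁ z3) = x z1 (y ◁ z2) = x y z. *)
Lemma adj_mul x y z : adj (x · y) z = \Sw_(a, b <- z) adj x a · adj y b.
Proof.
move: z; apply: sweedler_mul_inj => [||z]; try by lin.
rewrite mul_adj.
transitivity (\Sw_(a, b <- z) \Sw_(c, d <- b) a · (adj x c · adj y d)); last first.
  by apply: eq_tlift => a b; rewrite !lin_tlift //; lin.
rewrite -(sweedler_coassoc (F := fun a b c => a · (adj x b · adj y c))); try by lin.
have L : linear (fun u => x · u) by lin.
rewrite -mulHA -(mul_adj y z) (lin_tlift _ _ L); apply: eq_tlift => a b.
have L' : linear (fun u => u · adj y b) by lin.
rewrite mulHA -(mul_adj x a) (lin_tlift _ _ L').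
by apply: eq_tlift => c d; rewrite mulHA.
Qed.

(** Compatibility of the action with the comultiplication. Multiplying on the
    left by z turns the left-hand side into
    z1 (y1 ◁ z2) ⊗ y2 z3 = y1 z1 ⊗ y2 z2, and the right-hand side into
    z1 (y ◁ z3)_1 ⊗ z2 (y ◁ z3)_2 = Δ(z1 (y ◁ z2)); both are Δ(y z). *)
Lemma comul_adj y z :
  \Sw_(a, b <- y) \Sw_(c, d <- z) adj a c ⊗ₜ (b · d) =
  \Sw_(a, b <- z) \Sw_(c, d <- adj y b) c ⊗ₜ (a · d).
Proof.
pose act h := tlift (fun u v : H => (h · u) ⊗ₜ v).
have actE h u v : act h (u ⊗ₜ v) = (h · u) ⊗ₜ v by rewrite /act tliftE //; lin.
have actB : bilin act by rewrite /act; lin.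
have [actl actr] := actB.
move: z; apply: (sweedler_inj actB) => [w|a b w|||z]; try by lin.
- rewrite [w in RHS]tensor_sum; apply: eq_bigr => p _.
  by rewrite (hopf_unitl hopfH).
- rewrite [act b w]/act lin_tlift //.
  by apply: eq_tlift => u v; rewrite actE mulHA.
transitivity (Delta (y · z)).
  have -> : Delta (y · z) = \Sw_(a, b <- y · z) a ⊗ₜ b by exact: tensor_sum.
  rewrite sweedler_mul; last by lin.
  transitivity (\Sw_(p, q <- z) \Sw_(a, b <- y) \Sw_(c, d <- q)
      (p · adj a c) ⊗ₜ (b · d)).
    apply: eq_tlift => p q; rewrite lin_tlift //; apply: eq_tlift => a b.
    by rewrite lin_tlift //; apply: eq_tlift.
  rewrite tlift_exchange; apply: eq_tlift => a b.
  rewrite -(sweedler_coassoc (F := fun p c d => (p · adj a c) ⊗ₜ (b · d))); try by lin.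
  apply: eq_tlift => p q.
  have L : linear (fun u : H => u ⊗ₜ (b · q)) by lin.
  by rewrite -(lin_tlift _ _ L) mul_adj.
transitivity (\Sw_(p, q <- z) \Sw_(a, b <- q) \Sw_(c, d <- adj y b)
    (p · c) ⊗ₜ (a · d)); last first.
  apply: eq_tlift => p q; rewrite lin_tlift //; apply: eq_tlift => a b.
  by rewrite lin_tlift //; apply: eq_tlift.
rewrite -(sweedler_coassoc (F := fun p a b => \Sw_(c, d <- adj y b)
    (p · c) ⊗ₜ (a · d))); try by lin.
rewrite -(mul_adj y z) lin_tlift; last by lin.
apply: eq_tlift => p q; exact: (hopf_comulM hopfH).
Qed.

(** * The braiding *)

Local Notation R := (R_H mu Delta S).

Lemma R_tens x y : R (x ⊗ₜ y) = \Sw_(a, b <- y) a ⊗ₜ adj x b.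
Proof.
rewrite /R_H (tliftE _ _ (R_H_bilin _ _ _)) /comul3 /tmap.
rewrite lin_tlift; last exact/tlift_linear/R_H_bilin_outer.
transitivity (\Sw_(a, c <- y) \Sw_(a', b <- a) R_H_term mu S x a' b c).
  by apply: eq_tlift => a b; rewrite (tliftE _ _ (R_H_bilin_outer _ _ _)).
rewrite /R_H_term sweedler_coassoc; try by lin.
by apply: eq_tlift => a b; rewrite /adj !lin_tlift //; lin.
Qed.

Lemma on12_R x y z :
  on12 R ((x ⊗ₜ y) ⊗ₜ z) = \Sw_(a, b <- y) (a ⊗ₜ adj x b) ⊗ₜ z.
Proof.
have L : linear (fun t : H ⊗ H => t ⊗ₜ z) by lin.
rewrite /on12 /tmap tliftE; last by lin.
by rewrite R_tens -(lin_tlift _ _ L).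
Qed.

Lemma on23_R x y z :
  on23 R ((x ⊗ₜ y) ⊗ₜ z) = \Sw_(a, b <- z) (x ⊗ₜ a) ⊗ₜ adj y b.
Proof.
rewrite /on23 /= /assocr /tmap /assocl.
rewrite !tliftE ?R_tens ?lin_tlift; try by lin.
by apply: eq_tlift => a b; rewrite !tliftE //; lin.
Qed.

Lemma mul12_tens x y z : mul12 mu ((x ⊗ₜ y) ⊗ₜ z) = (x · y) ⊗ₜ z.
Proof. by rewrite /mul12 /tmap tliftE //; lin. Qed.

Lemma mul23_tens x y z : mul23 mu ((x ⊗ₜ y) ⊗ₜ z) = x ⊗ₜ (y · z).
Proof. by rewrite /mul23 /= /assocr /tmap !tliftE //; lin. Qed.

Lemma on12_linear : linear (on12 R).
Proof. by rewrite /on12 /tmap; lin. Qed.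

Lemma on23_linear : linear (on23 R).
Proof. by rewrite /on23 /comp /assocl /tmap /assocr; lin. Qed.

Lemma mul12_linear : linear (mul12 mu).
Proof. by rewrite /mul12 /tmap; lin. Qed.

Lemma mul23_linear : linear (mul23 mu).
Proof. by rewrite /mul23 /comp /tmap /assocr; lin. Qed.

Local Hint Resolve on12_linear on23_linear mul12_linear mul23_linear : lin.

Lemma R_YI : mul23 mu \o on12 R \o on23 R =1 R \o mul12 mu.
Proof.
apply: tensor3_ext => [||x y z]; try by rewrite /comp; lin.
rewrite /= on23_R mul12_tens R_tens !lin_tlift; try by lin.
transitivity (\Sw_(a, b <- z) \Sw_(c, d <- a) c ⊗ₜ (adj x d · adj y b)).
  apply: eq_tlift => a b; rewrite on12_R lin_tlift; last by lin.
  by apply: eq_tlift => c d; rewrite mul23_tens.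
rewrite (sweedler_coassoc (F := fun c d b => c ⊗ₜ (adj x d · adj y b))); try by lin.
by apply: eq_tlift => a b; rewrite adj_mul !lin_tlift //; lin.
Qed.

Lemma R_IY : mul12 mu \o on23 R \o on12 R =1 R \o mul23 mu.
Proof.
apply: tensor3_ext => [||x y z]; try by rewrite /comp; lin.
rewrite /= on12_R mul23_tens R_tens sweedler_mul ?lin_tlift; try by lin.
apply: eq_tlift => a b; rewrite on23_R lin_tlift; last by lin.
by apply: eq_tlift => c d; rewrite mul12_tens adj_adj.
Qed.

(** The two sides agree once [comul_adj] has been applied under the linear map
    u ⊗ v |-> p ⊗ u ⊗ (x ◁ v), where p is the first component of z. *)
Lemma R_braid : on12 R \o on23 R \o on12 R =1 on23 R \o on12 R \o on23 R.
Proof.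
apply: tensor3_ext => [||x y z]; try by rewrite /comp; lin.
rewrite /= on12_R on23_R !lin_tlift; try by lin.
transitivity (\Sw_(p, q <- z) \Sw_(a, b <- y) \Sw_(c, d <- q)
    (p ⊗ₜ adj a c) ⊗ₜ adj x (b · d)).
  rewrite [RHS]tlift_exchange; apply: eq_tlift => a b.
  rewrite on23_R lin_tlift; last by lin.
  rewrite -(sweedler_coassoc
    (F := fun p c d => (p ⊗ₜ adj a c) ⊗ₜ adj x (b · d))); try by lin.
  by apply: eq_tlift => c d; rewrite on12_R adj_adj.
transitivity (\Sw_(p, q <- z) \Sw_(a, b <- q) \Sw_(c, d <- adj y b)
    (p ⊗ₜ c) ⊗ₜ adj x (a · d)).
  apply: eq_tlift => p q.
  pose L := tlift (fun u v : H => (p ⊗ₜ u) ⊗ₜ adj x v).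
  have LE u v : L (u ⊗ₜ v) = (p ⊗ₜ u) ⊗ₜ adj x v by rewrite /L tliftE //; lin.
  have LL : linear L by rewrite /L; lin.
  have := congr1 L (comul_adj y q); rewrite !lin_tlift // => E.
  apply: etrans (etrans E _); apply: eq_tlift => a b; rewrite lin_tlift //;
    by apply: eq_tlift => c d; rewrite LE.
rewrite -(sweedler_coassoc (F := fun p a b => \Sw_(c, d <- adj y b)
    (p ⊗ₜ c) ⊗ₜ adj x (a · d))); try by lin.
apply: eq_tlift => a b; rewrite on12_R lin_tlift; last by lin.
apply: eq_tlift => c d; rewrite on23_R.
by apply: eq_tlift => e f; rewrite adj_adj.
Qed.

End Braiding.

Theorem lemma2p6 (k : comPzRingType) (H : lmodType k)
    (mu : {linear H ⊗ H -> H}) (Delta : {linear H -> H ⊗ H})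
    (eta : {linear k^o -> H}) (eps : {linear H -> k^o}) (S : {linear H -> H}) :
  hopf_algebra mu Delta eta eps S ->
  bijective (R_H mu Delta S) ->
  braided_algebra mu (R_H mu Delta S).
Proof.
move=> hopfH Rbij; split.
- exact: hopf_assoc hopfH.
- by split; [exact: Rbij | exact: (R_braid hopfH)].
- exact: (R_YI hopfH).
- exact: (R_IY hopfH).
Qed.
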